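(* Let $X$ be a Hilbert space, and let $Z\in B(X)$ be singular. Then $$\mathfrak{S}_\cap(Z)=\{\lambda I\mid\lambda\in\mathbb{C}\}.$$ If $X\cong\mathbb{C}^n$ is finite-dimensional and $\varphi:\operatorname{End}(\mathbb{C}^n)\to\operatorname{End}(\mathbb{C}^n)$ is a bounded linear map, then either $\mathfrak{S}^\varphi_\cap(Z)=\{\lambda I\mid\lambda\in\mathbb{C}\}$ or $\mathfrak{S}^\varphi_\cap(Z)=\operatorname{End}(\mathbb{C}^n)$.
   Context: $B(X)$ is the Banach algebra of bounded linear operators on the complex Hilbert space $X$ (so $B(\mathbb{C}^n)=\operatorname{End}(\mathbb{C}^n)$), and $B(X)^\times$ its group of invertible elements. ''Singular'' means not invertible. For a bounded linear map $\varphi$ from $B(X)$ to a Banach space and $A,Z\in B(X)$ put $$\mathfrak{N}^\varphi_\cap(A,Z) := \limsup_{r\to 0}\ \sup_{U\in B(X)^\times,\ \|U-Z\|<r}\|\varphi(UAU^{-1})\|,\qquad \mathfrak{S}^\varphi_\cap(Z) := \{A\in B(X)\mid \mathfrak{N}^\varphi_\cap(A,Z)<\infty\},$$ and $\mathfrak{S}_\cap(Z):=\mathfrak{S}^{\mathrm{id}}_\cap(Z)$, where $\mathrm{id}$ is the identity map of $B(X)$.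
   Formalization: The first assertion is proved for singular Z that are norm limits of invertible operators (automatic in finite dimension); for other singular Z, e.g. the unilateral shift on l^2, the inner supremum is over an empty set and the printed equality fails. *)

(* Defs.v *)
From HB Require Import structures.
From mathcomp Require Import all_boot all_order all_algebra.
From mathcomp Require Import all_classical all_reals all_analysis.
From mathcomp Require Import complex.

Set Implicit Arguments.
Unset Strict Implicit.
Unset Printing Implicit Defensive.

Import Order.TTheory GRing.Theory Num.Theory.
Import numFieldNormedType.Exports.

Local Open Scope classical_set_scope.
Local Open Scope ring_scope.
Local Open Scope complex_scope.

(* Over the scalar field R[i] the library norm `|x| takes its values in R[i];
   rnorm x is the same number, read in R. *)
Definition rnorm (R : realType) (X : normedModType R[i]) (x : X) : R :=
  complex.Re `|x|.

Lemma Re_normrK (R : realType) (z : R[i]) : (complex.Re `|z|)%:C = `|z|.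
Proof. exact/RRe_real/normr_real. Qed.

Lemma Re_normr_ge0 (R : realType) (z : R[i]) : 0 <= complex.Re `|z|.
Proof. by rewrite -lecR Re_normrK; exact: normr_ge0. Qed.

Section RnormTheory.
Variables (R : realType) (X : normedModType R[i]).
Implicit Types x y : X.

Lemma rnormE x : (rnorm x)%:C = `|x|.
Proof. exact/RRe_real/normr_real. Qed.

Lemma rnorm_ge0 x : 0 <= rnorm x.
Proof. by rewrite -lecR rnormE; exact: normr_ge0. Qed.

Lemma rnorm0 : rnorm (0 : X) = 0.
Proof. by apply: complexI; rewrite rnormE normr0. Qed.

Lemma rnorm_eq0 x : rnorm x = 0 -> x = 0.
Proof. by move=> x0; apply/normr0_eq0; rewrite -rnormE x0. Qed.

Lemma ler_rnormD x y : rnorm (x + y) <= rnorm x + rnorm y.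
Proof. by rewrite -lecR rmorphD /= !rnormE ler_normD. Qed.

Lemma rnormZ (l : R[i]) x : rnorm (l *: x) = complex.Re `|l| * rnorm x.
Proof.
apply: complexI; rewrite rnormE normrZ -rnormE -[X in X * _ = _]Re_normrK.
exact/esym/rmorphM.
Qed.

End RnormTheory.

Section BoundedOperators.
Variables (R : realType) (X Y : normedModType R[i]).

Definition bounded_linear (f : X -> Y) : Prop :=
  linear f /\ exists M : R, forall x, rnorm (f x) <= M * rnorm x.

Definition bounded_linear_pred : {pred X -> Y} := fun f => `[< bounded_linear f >].

(* B(X, Y) *)
Record bop := BOp { bop_fun :> X -> Y ; _ : bop_fun \in bounded_linear_pred }.

HB.instance Definition _ := [isSub for bop_fun].
HB.instance Definition _ := [Choice of bop by <:].

Lemma bounded_linear_submod_closed : submod_closed bounded_linear_pred.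
Proof.
split.
  apply/asboolP; split; first by move=> a u v /=; rewrite scaler0 addr0.
  by exists 0 => x; rewrite rnorm0 mul0r.
move=> a f g /asboolP[fl [M fM]] /asboolP[gl [N gN]]; apply/asboolP; split.
  move=> b u v; rewrite !fctE fl gl.
  rewrite !scalerDr !scalerA [a * b]mulrC -!addrA; congr (_ + _).
  by rewrite addrCA.
exists (complex.Re `|a| * M + N) => x.
apply: (le_trans (ler_rnormD _ _)); rewrite mulrDl lerD// rnormZ -mulrA ler_wpM2l//.
exact: Re_normr_ge0.
Qed.

HB.instance Definition _ := GRing.isSubmodClosed.Build _ _ bounded_linear_pred
  bounded_linear_submod_closed.
HB.instance Definition _ := [SubChoice_isSubLmodule of bop by <:].

Lemma bopP (T : bop) : bounded_linear T.
Proof. by case: T => f /= /asboolP. Qed.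

Lemma bop_ext (S T : bop) : S =1 T -> S = T.
Proof. by move=> ST; apply/val_inj/funext. Qed.

Lemma bopZ (T : bop) (a : R[i]) x : T (a *: x) = a *: T x.
Proof.
have [Tl _] := bopP T.
have T0 : T 0 = 0.
  by have := Tl (-1) 0 0; rewrite scaler0 addr0 scaleN1r addNr.
by have := Tl a x 0; rewrite T0 !addr0.
Qed.

Lemma bopD (T : bop) x y : T (x + y) = T x + T y.
Proof. by have [Tl _] := bopP T; have := Tl 1 x y; rewrite !scale1r. Qed.

Lemma bop0 (T : bop) : T 0 = 0.
Proof. by rewrite -(scale0r 0) bopZ scale0r. Qed.

Definition opnorm (T : bop) : R := sup [set rnorm (T x) | x in [set x | rnorm x <= 1]].

Lemma opnorm_has_sup (T : bop) :
  has_sup [set rnorm (T x) | x in [set x | rnorm x <= 1]].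
Proof.
split; first by exists (rnorm (T 0)), 0 => //=; rewrite rnorm0 ler01.
have [_ [M TM]] := bopP T; exists `|M| => _ [x /= x1 <-].
apply: (le_trans (TM x)); apply: (le_trans (ler_norm _)).
by rewrite normrM ler_piMr// ger0_norm// rnorm_ge0.
Qed.

Lemma opnorm_ub (T : bop) x : rnorm x <= 1 -> rnorm (T x) <= opnorm T.
Proof. by move=> x1; apply: ub_le_sup; [case: (opnorm_has_sup T)|exists x]. Qed.

Lemma opnorm_le (T : bop) (M : R) :
  (forall x, rnorm x <= 1 -> rnorm (T x) <= M) -> opnorm T <= M.
Proof.
move=> TM; apply: ge_sup; first by case: (opnorm_has_sup T).
by move=> _ [x /= x1 <-]; exact: TM.
Qed.

Lemma opnorm_ge0 (T : bop) : 0 <= opnorm T.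
Proof.
have /(opnorm_ub T) : rnorm (0 : X) <= 1 by rewrite rnorm0 ler01.
exact/le_trans/rnorm_ge0.
Qed.

Lemma opnormP (T : bop) x : rnorm (T x) <= opnorm T * rnorm x.
Proof.
have [/rnorm_eq0 ->|x0] := eqVneq (rnorm x) 0.
  by rewrite bop0 !rnorm0 mulr0.
have xp : 0 < rnorm x by rewrite lt_neqAle eq_sym x0 rnorm_ge0.
have ReV : complex.Re `|(rnorm x)%:C^-1 : R[i]| = (rnorm x)^-1.
  by rewrite -fmorphV normc_def /= expr0n addr0 sqrtr_sqr ger0_norm// invr_ge0 ltW.
have := @opnorm_ub T ((rnorm x)%:C^-1 *: x).
rewrite bopZ !rnormZ ReV mulVf// => /(_ (lexx _)).
by rewrite mulrC ler_pdivrMr.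
Qed.

Fact bop_norm_triangle (S T : bop) :
  (opnorm (S + T))%:C <= (opnorm S)%:C + (opnorm T)%:C.
Proof.
rewrite -rmorphD lecR; apply: opnorm_le => x x1.
by apply: (le_trans (ler_rnormD _ _)); rewrite lerD// opnorm_ub.
Qed.

Let opnormZ_le (l : R[i]) (T : bop) : opnorm (l *: T) <= complex.Re `|l| * opnorm T.
Proof.
apply: opnorm_le => x x1; rewrite [X in rnorm X](_ : _ = l *: T x)// rnormZ.
by rewrite ler_wpM2l ?opnorm_ub// Re_normr_ge0.
Qed.

Fact bop_normZ (l : R[i]) (T : bop) : (opnorm (l *: T))%:C = `|l| * (opnorm T)%:C.
Proof.
rewrite -[in RHS]Re_normrK -rmorphM; congr _%:C; apply/eqP.
rewrite eq_le opnormZ_le andTb.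
have [->|l0] := eqVneq l 0; first by rewrite normr0 mul0r opnorm_ge0.
have lp : 0 < complex.Re `|l| by rewrite -ltcR Re_normrK normr_gt0.
rewrite -{1}[T]scale1r -(mulVf l0) -scalerA.
apply: (le_trans (ler_wpM2l (ltW lp) (opnormZ_le _ _))).
rewrite mulrA [X in X * _](_ : _ = 1) ?mul1r//.
have CM (a b : R) : (a * b)%:C = a%:C * b%:C by exact: rmorphM.
by apply: complexI; rewrite CM !Re_normrK -normrM mulfV// normr1.
Qed.

Fact bop_norm_eq0 (T : bop) : (opnorm T)%:C = 0 -> T = 0.
Proof.
move=> /complexI T0; apply: bop_ext => x; apply: rnorm_eq0; apply/eqP.
by rewrite eq_le rnorm_ge0 andbT (le_trans (opnormP T x))// T0 mul0r.
Qed.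

HB.instance Definition _ := @Lmodule_isNormed.Build R[i] bop
  (fun T => (opnorm T)%:C) bop_norm_triangle bop_normZ bop_norm_eq0.

Lemma bop_rnormE (T : bop) : rnorm T = opnorm T.
Proof. by []. Qed.

End BoundedOperators.

Section BoundedRing.
Variables (R : realType) (X : normedModType R[i]).

Fact bop_id_subproof : idfun \in @bounded_linear_pred R X X.
Proof. by apply/asboolP; split => //; exists 1 => x; rewrite mul1r. Qed.

Definition bop_id : bop X X := BOp bop_id_subproof.

Fact bop_comp_subproof (S T : bop X X) : S \o T \in @bounded_linear_pred R X X.
Proof.
apply/asboolP; split; first by move=> a x y /=; rewrite !bopD !bopZ.
exists (opnorm S * opnorm T) => x /=; apply: (le_trans (opnormP _ _)).
by rewrite -mulrA ler_wpM2l ?opnorm_ge0// opnormP.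
Qed.

Definition bop_comp (S T : bop X X) : bop X X := BOp (bop_comp_subproof S T).

Fact bop_compA : associative bop_comp.
Proof. by move=> S T U; exact: bop_ext. Qed.
Fact bop_comp1l : left_id bop_id bop_comp.
Proof. by move=> S; exact: bop_ext. Qed.
Fact bop_comp1r : right_id bop_id bop_comp.
Proof. by move=> S; exact: bop_ext. Qed.
Fact bop_compDl : left_distributive bop_comp +%R.
Proof. by move=> S T U; exact: bop_ext. Qed.
Fact bop_compDr : right_distributive bop_comp +%R.
Proof. by move=> S T U; apply: bop_ext => x; exact: bopD. Qed.

(* pzRingType rather than nzRingType: X may be {0}. *)
HB.instance Definition _ := GRing.Zmodule_isPzRing.Build (bop X X)
  bop_compA bop_comp1l bop_comp1r bop_compDl bop_compDr.

Definition is_inverse (U V : bop X X) : Prop := U * V = 1 /\ V * U = 1.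

(* B(X)^x *)
Definition invertible : set (bop X X) := [set U | exists V, is_inverse U V].

(* U^-1, with the junk value 0 when U is not invertible *)
Definition bop_inv (U : bop X X) : bop X X := xget 0 (is_inverse U).

Definition scalar_operators : set (bop X X) := 
  [set lambda *: bop_id | lambda in [set: R[i]]].

End BoundedRing.

Section Conjugation.
Variables (R : realType) (X Y : normedModType R[i]).
Variable phi : bop (bop X X) Y.

(* r --> 0 is r --> 0 with r > 0: for r <= 0 no U satisfies the constraint. *)
Definition Ncap (A Z : bop X X) : \bar R :=
  limf_esup (fun r : R => ereal_sup
    [set (rnorm (phi (U * A * bop_inv U)))%:E
      | U in [set U | invertible U /\ rnorm (U - Z) < r]]) 0^'+.

Definition Scap (Z : bop X X) : set (bop X X) := [set A | (Ncap A Z < +oo)%E].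

End Conjugation.

(* In infinite dimension a singular Z need not be a limit of invertible operators
   (e.g. the unilateral shift).  For such Z the inner supremum is eventually the
   supremum of the empty set, so every A belongs to Scap phi Z. *)
Lemma Scap_notin_closure (R : realType) (X Y : normedModType R[i]) (phi : bop (bop X X) Y) (Z : bop X X) :
  ~ closure (@invertible R X) Z -> Scap phi Z = setT.
Proof.
move=> nc; apply/seteqP; split => // A _ /=.
have [e e0 He] : exists2 e : R, 0 < e & forall U, invertible U -> ~ rnorm (U - Z) < e.
  apply: contrapT => H; apply: nc => B /nbhs_ballP [e /= e0 HB].
  have er : (complex.Re e)%:C = e by apply: RRe_real; apply: gtr0_real.
  apply: contrapT => BN; apply: H; exists (complex.Re e); first by rewrite -ltcR er.
  move=> U iU Ue; apply: BN; exists U; split => //; apply: HB.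
  by rewrite -ball_normE /= distrC -rnormE -er ltcR.
rewrite /Scap /Ncap /limf_esup /=.
apply: (@le_lt_trans _ _ -oo%E) => //.
apply: ereal_inf_lbound; exists [set r : R | r < e] => /=; last first.
 apply/eqP; rewrite eq_le leNye andbT; apply: ge_ereal_sup; move=> y [r /= re <-].
 apply: ge_ereal_sup; move=> y0 [U [iU Ur] ?]; exfalso; exact: (He U iU (lt_trans Ur re)).
  exact: (@nbhs_right_lt R 0 e e0).
Qed.

Definition Scap_id (R : realType) (X : normedModType R[i]) (Z : bop X X) :
  set (bop X X) := Scap (bop_id (bop X X)) Z.

(* X is isomorphic to C^n; any linear isomorphism of normed spaces of finite
   dimension is a homeomorphism *)
Definition has_dimension (R : realType) (X : normedModType R[i]) (n : nat) : Prop :=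
  exists f : {linear 'rV[R[i]]_n -> X}, bijective f.

(* the inner product is linear in its first argument *)
Definition is_inner_product (R : realType) (X : normedModType R[i])
  (dot : {dot X for (@Num.conj R[i])}) : Prop := forall x : X, `|x| ^+ 2 = dot x x.

(* Main.v *)
Require Import Defs.
From mathcomp Require Import all_boot all_order all_algebra.
From mathcomp Require Import all_classical all_reals all_analysis.
From mathcomp Require Import complex.
From mathcomp Require Import ring lra.
Import Order.TTheory GRing.Theory Num.Theory.
Import numFieldNormedType.Exports.
Local Open Scope classical_set_scope.
Local Open Scope ring_scope.
Local Open Scope complex_scope.

Set Implicit Arguments.
Unset Strict Implicit.
Unset Printing Implicit Defensive.

(* The set S(Z) of all A with bounded conjugates U A U^-1 near Z is a linear
   subspace containing the scalars.  If B^2 = 0 then 1 + tB is invertible with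
   inverse 1 - tB, and U (1 + tB) stays close to Z for small t, so S(Z) contains
   (1 + tB) A (1 - tB); separating even and odd powers of t, it contains BAB and
   BA - AB.  Taking B = p (x) q^* with p orthogonal to q, in finite dimension
   S(Z) is a Lie ideal of gl_n, hence the scalars or everything.

   For phi = id the same computation is quantitative: for U near Z,
   |<Ap, q>| |U p| |<v, q>| <= C |U v| whenever p and q are orthogonal.
   If Z <> 0 is a singular limit of invertible operators, there are U near Z and
   unit vectors v with |U v| as small as desired.  Such a v keeps a component
   orthogonal to any p with Z p <> 0, which forces Ap to be parallel to p.
   If Z = 0, every scalar multiple s I is near Z for small s, and the inequality,
   applied to arbitrarily large p, gives <Ap, q> = 0. *)

(** * Operator algebra, and [Scap] in terms of radii and bounds *)

Section OperatorAlgebra.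
Context {R : realType} {X : normedModType R[i]}.
Implicit Types (A B S T U V : bop X X) (a : R[i]) (x : X).

Lemma bop_addE {Y : normedModType R[i]} (S T : bop X Y) x : (S + T) x = S x + T x.
Proof. by []. Qed.

Lemma bop_oppE {Y : normedModType R[i]} (S : bop X Y) x : (- S) x = - S x.
Proof. by []. Qed.

Lemma bop_scaleE {Y : normedModType R[i]} a (S : bop X Y) x : (a *: S) x = a *: S x.
Proof. by []. Qed.

Lemma bop_mulE S T x : (S * T) x = S (T x).
Proof. by []. Qed.

Lemma bopB {Y : normedModType R[i]} (T : bop X Y) x y : T (x - y) = T x - T y.
Proof. by rewrite -scaleN1r bopD bopZ scaleN1r. Qed.

Lemma bop_scalerAl a S T : (a *: S) * T = a *: (S * T).
Proof. exact: bop_ext. Qed.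

Lemma bop_scalerAr a S T : S * (a *: T) = a *: (S * T).
Proof. by apply: bop_ext => x; rewrite bop_scaleE !bop_mulE bopZ. Qed.

Lemma opnormM S T : opnorm (S * T) <= opnorm S * opnorm T.
Proof.
apply: opnorm_le => x x1; rewrite bop_mulE (le_trans (opnormP _ _))//.
by rewrite ler_wpM2l ?opnorm_ge0// opnorm_ub.
Qed.

Lemma is_inverse_uniq U V V' : is_inverse U V -> is_inverse U V' -> V = V'.
Proof. by move=> [_ VU] [UV' _]; rewrite -[V]mulr1 -UV' mulrA VU mul1r. Qed.

Lemma bop_invE U V : is_inverse U V -> bop_inv U = V.
Proof.
move=> iUV; apply: (is_inverse_uniq _ iUV).
exact: (xgetPex 0 (ex_intro (is_inverse U) V iUV)).
Qed.

Lemma is_inverse_nilpotent U V B : B * B = 0 -> is_inverse U V ->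
  is_inverse (U * (1 + B)) ((1 - B) * V).
Proof.
move=> BB [UV VU]; split.
  rewrite mulrA -[U * _ * _]mulrA mulrDl mul1r mulrBr mulr1 BB subr0 subrK.
  by rewrite mulr1.
rewrite mulrA -[_ * V * U]mulrA VU mulr1 mulrDr mulr1 mulrBl mul1r BB subr0.
by rewrite subrK.
Qed.

Lemma conj_nilpotent A B :
  (1 + B) * A * (1 - B) = (A - B * A * B) + (B * A - A * B).
Proof.
by rewrite mulrDl mul1r mulrBr mulr1 mulrDl opprD [- (A * B) - _]addrC addrACA.
Qed.

(** The inner supremum is monotone in the radius, so the limsup is below +oo as soon as a single
    positive radius admits a real bound. *)
Lemma ScapP {Y : normedModType R[i]} (phi : bop (bop X X) Y) (Z A : bop X X) :
  Scap phi Z A <-> exists r M : R, 0 < r /\ forall U V, is_inverse U V ->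
    rnorm (U - Z) < r -> rnorm (phi (U * A * V)) <= M.
Proof.
rewrite /Scap /Ncap /limf_esup /=; split.
  move=> /ereal_inf_lt[_ [D /= D0 <-] Doo].
  have [r /= r0 rD] : \forall x \near 0^'+, D x by [].
  have [s s0 Ds] : exists2 s, 0 < s & D s.
    exists (r / 2); first by rewrite divr_gt0.
    apply: rD => /=; last by rewrite divr_gt0.
    by rewrite sub0r normrN gtr0_norm ?divr_gt0// ltr_pdivrMr// ltr_pMr// ltr1n.
  set f := (X in ereal_sup (X @` _)) in Doo.
  have fs : (f s < +oo)%E.
    by apply: le_lt_trans Doo; apply: ereal_sup_ubound; exists s.
  have [M fM] : exists M : R, (f s <= M%:E)%E.
    case: (f s) fs => [M|//|] _; first by exists M.
    (* The value -oo occurs when no invertible U lies in the ball; any real bound then serves. *)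
    by exists 0; rewrite leNye.
  exists s, M; split => //.
  move=> U V UV UZ; rewrite -lee_fin; apply: le_trans fM.
  apply: ereal_sup_ubound; exists U; first by split => //; exists V.
  by rewrite (bop_invE UV).
move=> [r [M [r0 rM]]]; apply: (@le_lt_trans _ _ M%:E); last exact: ltry.
apply: ereal_inf_le => /=; eexists; first by exists [set s : R | s < r] => //;
  exact: nbhs_right_lt.
apply: ge_ereal_sup => _ [s /= sr <-]; apply: ge_ereal_sup => _ [U [[V UV] Us] <-].
by rewrite lee_fin (bop_invE UV) rM// (lt_trans Us).
Qed.

End OperatorAlgebra.

(** * Closure properties of [Scap phi Z] *)

Section ScapSubspace.
Context {R : realType} {X Y : normedModType R[i]}.
Variables (phi : bop (bop X X) Y) (Z : bop X X).
Implicit Types (A B S T U V : bop X X) (a : R[i]).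

Lemma Scap_scalar a : Scap phi Z (a *: (1 : bop X X)).
Proof.
apply/ScapP; exists 1, (rnorm (phi (a *: (1 : bop X X)))); split => // U V [UV _] _.
by rewrite bop_scalerAr bop_scalerAl mulr1 UV.
Qed.

Lemma ScapD A B : Scap phi Z A -> Scap phi Z B -> Scap phi Z (A + B).
Proof.
move=> /ScapP[r [M [r0 AM]]] /ScapP[s [N [s0 BN]]]; apply/ScapP.
exists (Num.min r s), (M + N); split; first by rewrite lt_min r0.
move=> U V UV; rewrite lt_min => /andP[Ur Us].
by rewrite mulrDr mulrDl bopD (le_trans (ler_rnormD _ _))// lerD ?AM ?BN.
Qed.

Lemma ScapZ a A : Scap phi Z A -> Scap phi Z (a *: A).
Proof.
move=> /ScapP[r [M [r0 AM]]]; apply/ScapP; exists r, (complex.Re `|a| * M); split => // U V UV Ur.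
by rewrite bop_scalerAr bop_scalerAl bopZ rnormZ ler_wpM2l ?Re_normr_ge0 ?AM.
Qed.

(** For W = U (1 + aB) one has W A W^-1 = U ((1 + aB) A (1 - aB)) V, and W is near Z when U is. Only
    |a| is prescribed, so that a and - a are both available. *)
Lemma Scap_conj_nilpotent A B : Scap phi Z A -> B * B = 0 ->
  exists2 t : R, 0 < t & forall a, `|a| = t%:C ->
    Scap phi Z ((1 + a *: B) * A * (1 - a *: B)).
Proof.
move=> /ScapP[r [M [r0 AM]]] BB.
have d0 : 0 < 1 + opnorm (Z * B) by rewrite ltr_wpDr ?opnorm_ge0.
(* In W - Z = (U - Z)(1 + aB) + a ZB, this t makes the second term at most r/2; the radius chosen
   for U below depends on a and makes the first less than r/2. *)
exists (r / 2 / (1 + opnorm (Z * B))); first by rewrite !divr_gt0.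
move=> a aE; apply/ScapP.
have e0 : 0 < 1 + opnorm (1 + a *: B) by rewrite ltr_wpDr ?opnorm_ge0.
exists (r / 2 / (1 + opnorm (1 + a *: B))), M; split; first by rewrite !divr_gt0.
move=> U V UV Ur; rewrite !mulrA -[_ * V]mulrA; apply: AM.
  by apply: is_inverse_nilpotent => //; rewrite bop_scalerAr bop_scalerAl BB !scaler0.
have -> : U * (1 + a *: B) - Z = (U - Z) * (1 + a *: B) + a *: (Z * B).
  by rewrite mulrBl (mulrDr Z) mulr1 bop_scalerAr opprD addrA subrK.
rewrite (le_lt_trans (ler_rnormD _ _))// rnormZ aE [ltRHS]splitr ltr_leD//.
  apply: le_lt_trans (opnormM _ _) _.
  rewrite ltr_pdivlMr// in Ur; apply: le_lt_trans Ur.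
  by rewrite ler_wpM2l ?opnorm_ge0// lerDr.
rewrite /= mulrAC ler_pdivrMr// ler_pM2l ?divr_gt0// bop_rnormE.
by rewrite lerDr.
Qed.

Lemma ScapB A B : Scap phi Z A -> Scap phi Z B -> Scap phi Z (A - B).
Proof. by move=> SA SB; rewrite -scaleN1r; apply: ScapD => //; exact: ScapZ. Qed.

(* Averaging (1 + B) A (1 - B) over B and - B isolates its even part A - BAB;
   the difference isolates its odd part BA - AB. *)
Lemma Scap_nilpotent A B : Scap phi Z A -> B * B = 0 ->
  Scap phi Z (B * A * B) /\ Scap phi Z (B * A - A * B).
Proof.
move=> SA BB; have [t t0 St] := Scap_conj_nilpotent SA BB.
have tC0 : t%:C != 0 :> R[i] by rewrite fmorph_eq0 gt_eqF.
have nt : `|t%:C| = t%:C :> R[i] by rewrite ger0_norm// lecR ltW.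
have := St t%:C nt; rewrite conj_nilpotent.
have := St (- t%:C); rewrite normrN nt => /(_ erefl); rewrite scaleNr conj_nilpotent.
rewrite ?(mulNr, mulrN, opprK).
set B' := t%:C *: B; set P := A - _; set Q := B' * A - A * B'.
have -> : - (B' * A) + A * B' = - Q by rewrite opprB addrC.
move=> SN SP; have SPP : Scap phi Z P.
  have -> : P = 2^-1 *: ((P + Q) + (P - Q)).
    rewrite addrACA subrr addr0 -mulr2n -(@scaler_nat R[i] (bop X X)) scalerA.
    by rewrite mulVf ?scale1r.
  by apply: ScapZ; exact: ScapD.
have SQ : Scap phi Z Q.
  by have -> : Q = (P + Q) - P; [rewrite addrC addKr|exact: ScapB].
split.
  have -> : B * A * B = (t%:C ^+ 2)^-1 *: (A - P).
    rewrite opprB addrC subrK /B' bop_scalerAr !bop_scalerAl !scalerA.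
    by rewrite -expr2 mulVf ?scale1r// expf_neq0.
  by apply: ScapZ; exact: ScapB.
have -> : B * A - A * B = t%:C^-1 *: Q; last exact: ScapZ.
by rewrite /Q /B' bop_scalerAr bop_scalerAl -scalerBr scalerA mulVf// scale1r.
Qed.

End ScapSubspace.

(** * Inner products and rank-one operators *)

Section RankOne.
Context {R : realType} {X : normedModType R[i]}.
Variables (dot : {dot X for (@Num.conj R[i])}) (hdot : is_inner_product dot).
Implicit Types (A B T U V : bop X X) (a : R[i]) (x y z p q : X).

Lemma dotC x y : dot x y = (dot y x)^*%R.
Proof. by rewrite (hermC dot) expr0 mul1r. Qed.

Lemma dot0l y : dot 0 y = 0. Proof. exact: linear0l. Qed.
Lemma dot0r y : dot y 0 = 0. Proof. exact: linear0r. Qed.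
Lemma dotDl x y z : dot (x + y) z = dot x z + dot y z.
Proof. exact: linearDl. Qed.
Lemma dotDr x y z : dot z (x + y) = dot z x + dot z y.
Proof. exact: linearDr. Qed.
Lemma dotBl x y z : dot (x - y) z = dot x z - dot y z.
Proof. exact: linearBl. Qed.
Lemma dotBr x y z : dot z (x - y) = dot z x - dot z y.
Proof. exact: linearBr. Qed.
Lemma dotZl a x y : dot (a *: x) y = a * dot x y.
Proof. exact: linearZl_LR. Qed.
Lemma dotZr a x y : dot x (a *: y) = a^*%R * dot x y.
Proof. exact: linearZr_LR. Qed.

Lemma dot_ortho_sym x y : dot x y = 0 -> dot y x = 0.
Proof. by move=> xy; rewrite dotC xy rmorph0. Qed.

Lemma dot_self_eq0 x : dot x x = 0 -> x = 0.
Proof. by move/eqP; rewrite (dnorm_eq0 dot) => /eqP. Qed.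

Lemma ortho_component x y : exists a, dot (x - a *: y) y = 0.
Proof.
have [->|y0] := eqVneq y 0; first by exists 0; rewrite dot0r.
exists (dot x y / dot y y); rewrite dotBl dotZl divfK ?subrr//.
by rewrite (dnorm_eq0 dot).
Qed.

Lemma dot_pythagoras a x y : dot x y = 0 ->
  dot (x + a *: y) (x + a *: y) = dot x x + `|a| ^+ 2 * dot y y.
Proof.
move=> xy; rewrite !(dotDl, dotDr, dotZl, dotZr) xy (dot_ortho_sym xy).
by rewrite !mulr0 addr0 add0r mulrA normCK.
Qed.

Lemma CauchySchwarz_dot x y : `|dot x y| <= `|x| * `|y|.
Proof.
have [->|y0] := eqVneq y 0; first by rewrite dot0r normr0 mulr_ge0.
have [a zy] := ortho_component x y.
have yy0 : dot y y != 0 by rewrite (dnorm_eq0 dot).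
have xy : dot x y = a * dot y y by move/eqP: zy; rewrite dotBl dotZl subr_eq0 => /eqP.
rewrite -(@ler_pXn2r _ 2)// ?nnegrE ?mulr_ge0// exprMn !hdot xy normrM exprMn mulrC.
rewrite ger0_norm ?(dnorm_ge0 dot)// expr2 -mulrA [leRHS]mulrC ler_wpM2l ?(dnorm_ge0 dot)//.
rewrite -[in leRHS](subrK (a *: y) x) dot_pythagoras// [leLHS]mulrC.
by rewrite lerDr (dnorm_ge0 dot).
Qed.

Lemma rnorm_dot_le x y : complex.Re `|dot x y| <= rnorm x * rnorm y.
Proof.
by rewrite -lecR Re_normrK rmorphM /= !rnormE CauchySchwarz_dot.
Qed.

Fact rank_one_subproof p q :
  (fun z => dot z q *: p) \in @bounded_linear_pred R X X.
Proof.
apply/asboolP; split; first by move=> a u v /=; rewrite dotDl dotZl scalerDl scalerA.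
exists (rnorm q * rnorm p) => x; rewrite rnormZ -mulrAC ler_wpM2r ?rnorm_ge0//.
by rewrite mulrC rnorm_dot_le.
Qed.

(** This is p (x) q^*, conjugate-linear in q, with trace [dot p q]. *)
Definition rank_one p q : bop X X := BOp (rank_one_subproof p q).

Lemma rank_oneE p q z : rank_one p q z = dot z q *: p.
Proof. by []. Qed.

Lemma opnorm_rank_one p q : opnorm (rank_one p q) <= rnorm p * rnorm q.
Proof.
apply: opnorm_le => x x1; rewrite rank_oneE rnormZ mulrC ler_wpM2l ?rnorm_ge0//.
by rewrite (le_trans (rnorm_dot_le _ _))// ler_piMl ?rnorm_ge0.
Qed.

Lemma rank_oneDl p p' q : rank_one (p + p') q = rank_one p q + rank_one p' q.
Proof. by apply: bop_ext => z; rewrite bop_addE !rank_oneE scalerDr. Qed.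

Lemma rank_oneDr p q q' : rank_one p (q + q') = rank_one p q + rank_one p q'.
Proof. by apply: bop_ext => z; rewrite bop_addE !rank_oneE dotDr scalerDl. Qed.

Lemma rank_oneZl a p q : rank_one (a *: p) q = a *: rank_one p q.
Proof.
by apply: bop_ext => z; rewrite bop_scaleE !rank_oneE !scalerA mulrC.
Qed.

Lemma rank_oneZr a p q : rank_one p (a *: q) = a^*%R *: rank_one p q.
Proof.
by apply: bop_ext => z; rewrite bop_scaleE !rank_oneE !scalerA dotZr.
Qed.

Lemma mul_rank_one T p q : T * rank_one p q = rank_one (T p) q.
Proof. by apply: bop_ext => z; rewrite bop_mulE !rank_oneE bopZ. Qed.

Lemma rank_one_conj A p q :
  rank_one p q * A * rank_one p q = dot (A p) q *: rank_one p q.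
Proof. by rewrite -mulrA !mul_rank_one rank_oneE rank_oneZl. Qed.

Lemma rank_one_nilpotent p q : dot p q = 0 -> rank_one p q * rank_one p q = 0.
Proof. by move=> pq; rewrite mul_rank_one rank_oneE pq rank_oneZl scale0r. Qed.

Lemma rank_one_commutator p q x y :
  rank_one p q * rank_one x y - rank_one x y * rank_one p q =
  dot x q *: rank_one p y - dot p y *: rank_one x q.
Proof. by rewrite !mul_rank_one !rank_oneE !rank_oneZl. Qed.

(** Taking for q the component of A x orthogonal to x shows that every x is an eigenvector; the
    eigenvalues then have to agree. *)
Lemma scalar_operatorP A :
  (forall p q, dot p q = 0 -> dot (A p) q = 0) -> exists a, A = a *: (1 : bop X X).
Proof.
move=> HA; have eigen x : exists a, A x = a *: x.
  have [a ax] := ortho_component (A x) x; exists a; apply/eqP; rewrite -subr_eq0.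
  have := HA x _ (dot_ortho_sym ax) => h; apply/eqP/dot_self_eq0.
  by rewrite {1}dotBl h dotZl dot_ortho_sym// mulr0 subr0.
have [[e e0]|/forallNP X0] := pselect (exists e : X, e != 0); last first.
  exists 0; apply: bop_ext => x; have /negP := X0 x.
  by rewrite negbK => /eqP ->; rewrite !bop0.
have [a Ae] := eigen e; exists a; apply: bop_ext => x.
(* Pairing A (y + e) with e shows that y + e has the same eigenvalue a as e, hence so has y. *)
have Aortho y : dot y e = 0 -> A y = a *: y.
  move=> ye; have [c Ac] := eigen (y + e); have [d Ad] := eigen y.
  have : dot (A (y + e)) e = a * dot e e by rewrite bopD dotDl Ad Ae !dotZl ye mulr0 add0r.
  rewrite Ac dotZl dotDl ye add0r => /mulIf ca.
  have {}ca : c = a by apply: ca; rewrite (dnorm_eq0 dot).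
  by move: Ac; rewrite bopD Ae ca scalerDr => /addIr.
suff : A x = a *: x by [].
have [b xe] := ortho_component x e.
rewrite -[x](subrK (b *: e)) bopD bopZ Ae (Aortho _ xe).
by rewrite [RHS]scalerDr !scalerA mulrC.
Qed.

End RankOne.

(** * Subspaces stable under the operations induced by nilpotents *)

Section ConjugationStableSubspace.
Context {R : realType} {X : normedModType R[i]}.
Variables (dot : {dot X for (@Num.conj R[i])}) (hdot : is_inner_product dot).
Implicit Types (A B S T U V : bop X X) (a : R[i]) (x y z p q u : X).

Local Notation rank_one := (rank_one hdot).

(* P is meant to be closed under the Gram-Schmidt steps: the sum S of the terms
   added so far is the orthogonal projection onto the span of the vectors treated. *)
Lemma orthogonal_expansion (P : set (bop X X)) (s : seq X) :
  P 0 -> (forall S h, h != 0 -> P S -> P (S + (dot h h)^-1 *: rank_one h h)) ->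
  (forall h, {in s, forall f, dot f h = 0} -> h = 0) -> P 1.
Proof.
move=> P0 PD s0.
(* The third clause puts the range of S in the double orthogonal complement of s, which stands for
   its span. *)
suff [S [PS S1 _]] : exists S, [/\ P S,
    forall x, {in s, forall f, dot f (x - S x) = 0} &
    forall x h, {in s, forall f, dot f h = 0} -> dot (S x) h = 0].
  suff -> : 1 = S by [].
  by apply: bop_ext => x; apply/subr0_eq/s0/S1.
elim: s {s0} => [|g s [S [PS Sres Sran]]].
  by exists 0; split => // x h _; rewrite dot0l.
have [h0|h0] := eqVneq (g - S g) 0.
  exists S; split => // [x f|x h sh].
    rewrite inE => /predU1P[->|/Sres//].
    by move/eqP: h0; rewrite subr_eq0 => /eqP ->; exact: Sran.
  by apply: Sran => f fs; apply: sh; rewrite inE fs orbT.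
set h := g - S g in h0; exists (S + (dot h h)^-1 *: rank_one h h).
have hs : {in s, forall f, dot f h = 0} by exact: Sres.
have hh0 : dot h h != 0 by rewrite (dnorm_eq0 dot).
split; first exact: PD.
- move=> x f; rewrite bop_addE bop_scaleE rank_oneE opprD addrA scalerA.
  rewrite dotBr dotZr inE => /predU1P[->|fs]; last by rewrite (Sres x f fs) (hs f fs) mulr0 subr0.
  have -> : dot g h = dot h h.
    by rewrite -{1}[g](subrK (S g)) dotDl (Sran _ h)// addr0.
  have -> : dot g (x - S x) = dot h x.
    rewrite -{1}[g](subrK (S g)) dotDl (Sran _ (x - _))// addr0 dotBr.
    by rewrite (dot_ortho_sym (Sran x _ hs)) subr0.
  by rewrite rmorphM fmorphV /= -!dotC mulrAC mulVf// mul1r subrr.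
- move=> x k sk; rewrite bop_addE bop_scaleE rank_oneE dotDl !dotZl.
  have ks : {in s, forall f, dot f k = 0} by move=> f fs; apply: sk; rewrite inE fs orbT.
  have -> : dot h k = 0 by rewrite dotBl (sk g (mem_head _ _)) (Sran _ _ ks) subrr.
  by rewrite (Sran _ _ ks) !mulr0 addr0.
Qed.

(** K abstracts [Scap phi Z], of which the hypotheses below have been established. *)
Variable K : set (bop X X).
Hypothesis K1 : K 1.
Hypothesis KD : forall A B, K A -> K B -> K (A + B).
Hypothesis KZ : forall a A, K A -> K (a *: A).
Hypothesis K_conj : forall A B, K A -> B * B = 0 ->
  K (B * A * B) /\ K (B * A - A * B).

Let KB A B : K A -> K B -> K (A - B).
Proof. by move=> KA KB'; rewrite -scaleN1r; apply: KD => //; exact: KZ. Qed.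

Let KZV a A : a != 0 -> K (a *: A) -> K A.
Proof. by move=> a0 /(KZ a^-1); rewrite scalerA mulVf// scale1r. Qed.

Let K0 : K 0.
Proof. by rewrite -(scale0r (1 : bop X X)); exact: KZ. Qed.

(** For B = x (x) y^* the product BAB is the nonzero multiple <Ax, y> B. *)
Lemma rank_one_of_dot_neq0 A x y : K A -> dot x y = 0 -> dot (A x) y != 0 ->
  K (rank_one x y).
Proof.
move=> KA xy Axy; apply: (KZV Axy); rewrite -rank_one_conj.
by have [] := K_conj KA (rank_one_nilpotent hdot xy).
Qed.

(** For A = p (x) q^* one has <Az, y> = <z, q> <p, y>, so the previous lemma applies directly when
    <x, q> is nonzero. *)
Lemma rank_one_transfer p q x y : K (rank_one p q) -> dot p q = 0 -> q != 0 ->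
  dot p y != 0 -> dot x y = 0 -> K (rank_one x y).
Proof.
move=> Kpq pq q0 py xy.
have step z : dot z y = 0 -> dot z q != 0 -> K (rank_one z y).
  by move=> zy zq; apply: (rank_one_of_dot_neq0 Kpq) => //; rewrite rank_oneE dotZl mulf_neq0.
(* This w is orthogonal to y but not to q: w = 0 would make q a multiple of y, against q <> 0, <p,
   q> = 0 and <p, y> <> 0. If <x, q> = 0, then x is written as (x + w) - w. *)
have [a wy] := ortho_component dot q y; set w := q - a *: y in wy.
have wq : dot w q != 0.
  have -> : dot w q = dot w w.
    by rewrite -{1}[q](subrK (a *: y)) dotDr dotZr wy mulr0 addr0.
  rewrite (dnorm_eq0 dot); apply: contraNneq q0 => w0.
  move/eqP: w0; rewrite subr_eq0 => /eqP qa.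
  move: pq; rewrite qa dotZr => /eqP; rewrite mulf_eq0 (negPf py) orbF fmorph_eq0.
  by move=> /eqP ->; rewrite scale0r.
have [xq|xq] := eqVneq (dot x q) 0; last exact: step.
have -> : rank_one x y = rank_one (x + w) y - rank_one w y by rewrite rank_oneDl addrK.
by apply: KB; apply: step => //; [rewrite dotDl xy wy addr0|rewrite dotDl xq add0r].
Qed.

(** When <p, y> = 0, the vector y is written as (y + w) - w, and neither term is orthogonal to p. *)
Lemma rank_one_transfer2 p q x y w : K (rank_one p q) -> dot p q = 0 -> q != 0 ->
  dot x w = 0 -> dot p w != 0 -> dot x y = 0 -> K (rank_one x y).
Proof.
move=> Kpq pq q0 xw pw xy.
have [py|py] := eqVneq (dot p y) 0; last exact: (rank_one_transfer Kpq).
have -> : rank_one x y = rank_one x (y + w) - rank_one x w by rewrite rank_oneDr addrK.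
apply: KB; apply: (rank_one_transfer Kpq) => //.
  by rewrite dotDr py add0r.
by rewrite dotDr xy xw addr0.
Qed.

(** A nonscalar A yields one orthogonal pair p, q with p (x) q^* in K; this operator and its swap q
    (x) p^* reach every orthogonal pair x, y. *)
Lemma ortho_rank_one A x y : K A -> ~ (exists a, A = a *: (1 : bop X X)) -> dot x y = 0 ->
  K (rank_one x y).
Proof.
move=> KA nA xy.
have [p [q [pq Apq]]] : exists p q, dot p q = 0 /\ dot (A p) q != 0.
  apply: contrapT => h; apply: nA; apply: (scalar_operatorP (dot := dot)) => p q pq.
  by apply/eqP; apply: contrapT => /negP Apq; apply: h; exists p, q.
have p0 : p != 0 by apply: contraNneq Apq => ->; rewrite bop0 dot0l.
have q0 : q != 0 by apply: contraNneq Apq => ->; rewrite dot0r.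
have qp := dot_ortho_sym pq.
have Kpq : K (rank_one p q) by exact: (rank_one_of_dot_neq0 KA).
have Kqp : K (rank_one q p).
  apply: (rank_one_transfer2 (w := p) Kpq) => //.
  by rewrite (dnorm_eq0 dot).
(* If w is nonzero, it is the auxiliary vector, since <p, w> = <w, w>. Otherwise x is parallel to p,
   hence orthogonal to q, and the swapped operator is used with q as auxiliary vector. *)
have [a wx] := ortho_component dot p x; set w := p - a *: x in wx.
have [w0|w0] := eqVneq w 0; last first.
  apply: (rank_one_transfer2 (w := w) Kpq) => //; first exact: dot_ortho_sym.
  rewrite -[p](subrK (a *: x)) dotDl dotZl (dot_ortho_sym wx) mulr0 addr0.
  by rewrite (dnorm_eq0 dot).
move/eqP: w0; rewrite subr_eq0 => /eqP pax.
have a0 : a != 0 by apply: contraNneq p0 => a0; rewrite pax a0 scale0r.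
apply: (rank_one_transfer2 (w := q) Kqp) => //.
  by apply: (mulfI a0); rewrite -dotZl -pax pq mulr0.
by rewrite (dnorm_eq0 dot).
Qed.

(* Modulo K every rank_one x x equals |x|^2 E with E of trace 1, so 1 = m E modulo
   K, where m > 0 is the dimension; hence E, and with it every operator, is in K. *)
Lemma subspace_full (s : seq X) A T :
  (forall h, {in s, forall f, dot f h = 0} -> h = 0) ->
  K A -> ~ (exists a, A = a *: (1 : bop X X)) -> K T.
Proof.
move=> s0 KA nA; have Ko x y := @ortho_rank_one A x y KA nA.
have [u u0] : exists u : X, u != 0.
  apply: contrapT => /forallNP X0; apply: nA; exists 0; apply: bop_ext => x.
  by have /negP := X0 x; rewrite negbK => /eqP ->; rewrite !bop0.
have uu0 : dot u u != 0 by rewrite (dnorm_eq0 dot).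
pose E := (dot u u)^-1 *: rank_one u u.
have Kdiag x : K (rank_one x x - dot x x *: E).
  have [a] := ortho_component dot x u.
  move: (x - a *: u) (subrK (a *: u) x) => y <- yu; have uy := dot_ortho_sym yu.
  rewrite (dot_pythagoras _ yu).
  rewrite rank_oneDl !rank_oneDr !rank_oneZl !rank_oneZr.
  have -> : (dot y y + `|a| ^+ 2 * dot u u) *: E = dot y y *: E + a *: (a^*%R *: rank_one u u).
    by rewrite scalerDl /E !scalerA mulfK// normCK.
  have -> : forall F G H I J : bop X X, F + G + (H + I) - (J + I) = (F - J) + G + H.
    by move=> F G H I J; rewrite addrA opprD addrACA subrr addr0 addrAC [F + G - J]addrAC.
  apply: KD; last by apply: KZ; apply: Ko.
  apply: KD; last by apply: KZ; apply: Ko.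
  (* Scaled by <u, u>, the remaining term is the commutator of y (x) u^* and u (x) y^*. *)
  apply: (KZV uu0); rewrite scalerBr /E !scalerA mulrAC mulfV// mul1r.
  rewrite -rank_one_commutator.
  by have [] := K_conj (Ko _ _ uy) (rank_one_nilpotent hdot yu).
have KE : K E.
  (* Each nonzero Gram-Schmidt vector adds one copy of E modulo K. The clause on m = 0 rules out m =
     0 for S = 1, as u <> 0. *)
  pose P S := exists m : nat, K (S - m%:R *: E) /\ (m = 0%N -> S = 0).
  have [m [K1m m0]] : P 1.
    apply: (@orthogonal_expansion _ s) => //.
      by exists 0%N; rewrite scale0r subr0.
    move=> S h h0 [m [KSm _]]; exists m.+1; split => //.
    have hh0 : dot h h != 0 by rewrite (dnorm_eq0 dot).
    rewrite -addn1 natrD scalerDl scale1r opprD addrACA; apply: KD => //.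
    by apply: (KZV hh0); rewrite scalerBr scalerA mulfV// scale1r.
  have [m00|m00] := eqVneq m 0%N.
    have := m0 m00 => /(congr1 (fun S : bop X X => S u)) u00.
    by case/eqP: u0.
  have mn0 : m%:R != 0 :> R[i] by rewrite pnatr_eq0.
  apply: (KZV mn0); have -> : m%:R *: E = 1 - (1 - m%:R *: E) by rewrite subKr.
  exact: KB.
have Kall x y : K (rank_one x y).
  have [a zy] := ortho_component dot x y.
  rewrite -[x](subrK (a *: y)) rank_oneDl rank_oneZl; apply: KD; first exact: Ko.
  apply: KZ; rewrite -(subrK (dot y y *: E) (rank_one y y)).
  by apply: KD => //; exact: KZ.
rewrite -[T]mulr1.
(* Expanding 1 writes T as a sum of multiples of (T h) (x) h^*, all in K. *)
apply: (@orthogonal_expansion (fun S => K (T * S)) s) => //; first by rewrite mulr0.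
move=> S h _ KTS; rewrite mulrDr bop_scalerAr mul_rank_one; apply: KD => //.
exact: KZ.
Qed.

End ConjugationStableSubspace.

(** * Singular limits of invertibles and almost-kernel vectors *)

Section NearKernel.
Context {R : realType}.

Lemma Re_normr_real (t : R) : complex.Re `|t%:C| = `|t|.
Proof. by rewrite normc_def /= expr0n addr0 sqrtr_sqr. Qed.

Lemma rnormN {X : normedModType R[i]} (x : X) : rnorm (- x) = rnorm x.
Proof. by rewrite /rnorm normrN. Qed.

Lemma rnormB_le {X : normedModType R[i]} (x y : X) : rnorm (x - y) <= rnorm x + rnorm y.
Proof. by rewrite -(rnormN y) ler_rnormD. Qed.

Lemma rnorm_distC {X : normedModType R[i]} (x y : X) : rnorm (x - y) = rnorm (y - x).
Proof. by rewrite -opprB rnormN. Qed.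

Lemma rnorm_gt0 {X : normedModType R[i]} (x : X) : (0 < rnorm x) = (x != 0).
Proof. by rewrite -ltcR rnormE normr_gt0. Qed.

Lemma rnorm_ballP {X : normedModType R[i]} (x y : X) (e : R) :
  ball x e%:C y <-> rnorm (x - y) < e.
Proof. by rewrite -ball_normE /= -rnormE ltcR. Qed.

Lemma closure_rnorm {X : normedModType R[i]} (S : set X) (x : X) (e : R) :
  closure S x -> 0 < e -> exists2 y, S y & rnorm (y - x) < e.
Proof.
move=> Sx e0; have [|y [Sy xy]] := Sx (ball x e%:C).
  by apply: nbhsx_ballx; rewrite ltcR.
by exists y => //; rewrite rnorm_distC; exact/rnorm_ballP.
Qed.

Context {X : completeNormedModType R[i]}.
Implicit Types (U V Z : bop X X) (x y v : X).

Lemma bounded_below_closure Z (r eta : R) : closure (@invertible R X) Z -> 0 < r ->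
  (forall U, invertible U -> rnorm (U - Z) < r -> forall v, eta * rnorm v <= rnorm (U v)) ->
  forall v, eta * rnorm v <= rnorm (Z v).
Proof.
move=> clZ r0 UZ v; apply/ler_addgt0Pr => e e0.
have d0 : 0 < 1 + rnorm v by rewrite ltr_wpDr ?rnorm_ge0.
have [|U iU] := closure_rnorm (e := Num.min r (e / (1 + rnorm v))) clZ.
  by rewrite lt_min r0 divr_gt0.
rewrite lt_min => /andP[Ur Ue]; apply: (le_trans (UZ U iU Ur v)).
have -> : U v = Z v + (U - Z) v by rewrite bop_addE bop_oppE addrC subrK.
apply: (le_trans (ler_rnormD _ _)); rewrite lerD2l; apply: (le_trans (opnormP _ _)).
rewrite ltr_pdivlMr// in Ue; apply: le_trans (ltW Ue).
by rewrite ler_wpM2l ?opnorm_ge0// lerDr.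
Qed.

(** Approximate preimages of y form a Cauchy sequence by the lower bound; completeness and
    continuity give a preimage. *)
Lemma surjective_of_bounded_below Z (eta : R) y : 0 < eta ->
  (forall v, eta * rnorm v <= rnorm (Z v)) ->
  (forall e : R, 0 < e -> exists x, rnorm (Z x - y) < e) ->
  exists x, Z x = y.
Proof.
move=> eta0 Zb dense.
have /choice[x_ Zx] : forall n : nat, exists x, rnorm (Z x - y) < n.+1%:R^-1.
  by move=> n; apply: dense; rewrite invr_gt0.
have small (e : R) : 0 < e -> exists N : nat, forall n, (N <= n)%N -> n.+1%:R^-1 < e.
  move=> e0; have [N _ NP] := near_infty_natSinv_lt (PosNum e0).
  by exists N => n Nn; exact: NP.
have : cvg (x_ @ \oo).
  apply/cauchy_cvgP/cauchy_exP => e e0.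
  have er : (complex.Re e)%:C = e by apply: RRe_real; apply: gtr0_real.
  have {}e0 : 0 < complex.Re e by rewrite -ltcR er.
  have [|N NP] := small (eta * complex.Re e / 2); first by rewrite !divr_gt0 ?mulr_gt0.
  exists (x_ N); exists N => // n /= Nn; rewrite -er; apply/rnorm_ballP.
  rewrite -(ltr_pM2l eta0); apply: (le_lt_trans (Zb _)).
  have -> : Z (x_ N - x_ n) = (Z (x_ N) - y) - (Z (x_ n) - y).
    by rewrite bopB opprB addrA subrK.
  apply: (le_lt_trans (rnormB_le _ _)); rewrite [ltRHS]splitr.
  by apply: ltrD; [apply: (lt_trans (Zx N)); apply: NP|apply: (lt_trans (Zx n)); apply: NP].
move=> /cvg_ex[x xl]; exists x; apply/subr0_eq/rnorm_eq0/eqP.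
rewrite eq_le rnorm_ge0 andbT; apply/ler_addgt0Pr => e e0; rewrite add0r.
have d0 : 0 < 1 + opnorm Z by rewrite ltr_wpDr ?opnorm_ge0.
have [|N NP] := small (e / 2); first by rewrite divr_gt0.
have [N' _ N'P] : \forall n \near \oo, ball x (e / 2 / (1 + opnorm Z))%:C (x_ n).
  by apply: xl; apply: nbhsx_ballx; rewrite ltcR !divr_gt0.
have /rnorm_ballP := N'P _ (leq_maxr N N'); have := NP _ (leq_maxl N N').
move: (maxn N N') => n nN; rewrite ltr_pdivlMr// => xn.
have -> : Z x - y = Z (x - x_ n) + (Z (x_ n) - y) by rewrite bopB addrA subrK.
apply: (le_trans (ler_rnormD _ _)); rewrite [leRHS]splitr lerD//; last exact/ltW/(lt_trans (Zx n)).
apply: (le_trans (opnormP _ _)); apply: le_trans (ltW xn).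
by rewrite mulrC ler_wpM2l ?rnorm_ge0// lerDr.
Qed.

Lemma invertible_of_bijective Z (eta : R) : 0 < eta ->
  (forall v, eta * rnorm v <= rnorm (Z v)) -> (forall y, exists x, Z x = y) ->
  invertible Z.
Proof.
move=> eta0 Zb /choice[g Zg].
have Zinj x y : Z x = Z y -> x = y.
  move=> Zxy; apply/subr0_eq/rnorm_eq0/eqP; rewrite eq_le rnorm_ge0 andbT.
  by rewrite -(ler_pM2l eta0) mulr0 (le_trans (Zb _))// bopB Zxy subrr rnorm0.
have gP : g \in @bounded_linear_pred R X X.
  apply/asboolP; split; first by move=> a u v; apply: Zinj; rewrite bopD bopZ !Zg.
  exists eta^-1 => x; rewrite mulrC ler_pdivlMr// mulrC.
  by apply: (le_trans (Zb _)); rewrite Zg.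
exists (BOp gP); split; apply: bop_ext => x; first exact: Zg.
by apply: Zinj; rewrite -[RHS]Zg.
Qed.

(** Otherwise all invertible U near Z share the lower bound eta. It passes to Z, and the vectors
    U^-1 y show that the range of Z is dense, so Z would be invertible. *)
Lemma approximate_kernel Z (r eta : R) : ~ invertible Z -> closure (@invertible R X) Z ->
  0 < r -> 0 < eta -> exists U V v,
    [/\ is_inverse U V, rnorm (U - Z) < r, rnorm v = 1 & rnorm (U v) < eta].
Proof.
move=> nZ clZ r0 eta0; apply: contrapT => h; apply: nZ.
have UZ U : invertible U -> rnorm (U - Z) < r -> forall v, eta * rnorm v <= rnorm (U v).
  move=> [V UV] Ur v; rewrite leNgt; apply/negP => Uv; apply: h.
  have v0 : 0 < rnorm v.
    rewrite rnorm_gt0; apply/eqP => v0.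
    by move: Uv; rewrite v0 bop0 rnorm0 mulr0 ltxx.
  exists U, V, ((rnorm v)^-1%:C *: v); split => //.
    by rewrite rnormZ Re_normr_real gtr0_norm ?invr_gt0// mulVf ?gt_eqF.
  by rewrite bopZ rnormZ Re_normr_real gtr0_norm ?invr_gt0// mulrC ltr_pdivrMr.
have Zb := bounded_below_closure clZ r0 UZ.
apply: (invertible_of_bijective eta0 Zb) => y.
apply: (surjective_of_bounded_below eta0 Zb) => e e0.
have d0 : 0 < 1 + rnorm y by rewrite ltr_wpDr ?rnorm_ge0.
(* Z (V y) - y = - (U - Z)(V y), and |V y| <= |y| / eta; this radius makes the error less than e. *)
have [|U [V [UV VU]]] := closure_rnorm (e := Num.min r (e * eta / (1 + rnorm y))) clZ.
  by rewrite lt_min r0 divr_gt0 ?mulr_gt0.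
rewrite lt_min => /andP[Ur Ue]; exists (V y).
have UVy : U (V y) = y by rewrite -bop_mulE UV.
have -> : Z (V y) - y = - ((U - Z) (V y)) by rewrite bop_addE bop_oppE UVy opprB.
rewrite rnormN -(ltr_pM2r eta0); rewrite ltr_pdivlMr// in Ue.
apply: le_lt_trans Ue; apply: (@le_trans _ _ (opnorm (U - Z) * rnorm y)).
  rewrite (le_trans (ler_wpM2r (ltW eta0) (opnormP _ _)))// -mulrA.
  by rewrite ler_wpM2l ?opnorm_ge0// mulrC -[in leRHS]UVy UZ//; exists V.
by rewrite ler_wpM2l ?opnorm_ge0// lerDr.
Qed.

End NearKernel.

(** * Quantitative estimates for the identity map *)

Section SingularScap.
Context {R : realType} {X : completeNormedModType R[i]}.
Variables (dot : {dot X for (@Num.conj R[i])}) (hdot : is_inner_product dot).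
Implicit Types (A B U V W Z : bop X X) (p q v w x : X).

Local Notation rank_one := (rank_one hdot).
Local Notation mdot x y := (complex.Re `|dot x y|).

(** The points U, U (1 + B) and U (1 - B) all lie in the ball, and 2 BAB is 2A minus the two
    conjugates of A by 1 + B and 1 - B: four terms, each bounded by M after conjugation by U. *)
Lemma opnorm_conj_nilpotent A B Z (r M : R) U V :
  (forall U V, is_inverse U V -> rnorm (U - Z) < r -> rnorm (U * A * V) <= M) ->
  is_inverse U V -> B * B = 0 -> opnorm (U - Z) + opnorm U * opnorm B < r ->
  opnorm (U * (B * A * B) * V) <= 2 * M.
Proof.
move=> AM UV BB Ur.
have half C : C * C = 0 -> opnorm C = opnorm B ->
    opnorm (U * ((1 + C) * A * (1 - C)) * V) <= M.
  move=> CC CB; rewrite !mulrA -[_ * V]mulrA; apply: AM; first exact: is_inverse_nilpotent.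
  have -> : U * (1 + C) - Z = (U - Z) + U * C by rewrite mulrDr mulr1 addrAC.
  apply: le_lt_trans Ur; apply: (le_trans (ler_rnormD _ _)); rewrite lerD2l -CB.
  exact: opnormM.
have {}AM : opnorm (U * A * V) <= M.
  apply: AM => //; apply: le_lt_trans Ur.
  by rewrite lerDl mulr_ge0 ?opnorm_ge0.
have hp := half B BB erefl; have := half (- B).
rewrite mulrNN BB -[opnorm (- B)]/(rnorm (- B)) rnormN => /(_ erefl erefl) hm.
move: hp hm AM; rewrite !conj_nilpotent ?(mulNr, mulrN, opprK).
have -> : - (B * A) + A * B = - (B * A - A * B) by rewrite opprB addrC.
move: (B * A * B) (B * A - A * B) => P Q.
have UVD S T : U * (S + T) * V = U * S * V + U * T * V by rewrite mulrDr mulrDl.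
rewrite !UVD !mulrN !mulNr.
move: (U * A * V) (U * P * V) (U * Q * V) => a p q hp hm ha.
rewrite -(ler_pM2l (ltr0n R 2)).
have -> : 2 * opnorm p = rnorm (p + p).
  rewrite -mulr2n -(@scaler_nat R[i] (bop X X)) rnormZ.
  have -> : 2 = (2 : R)%:C :> R[i] by rewrite rmorph_nat.
  by rewrite Re_normr_real ger0_norm.
have -> : p + p = (a + a) - ((a - p + q) + (a - p - q)).
  rewrite addrACA subrr addr0 opprD !opprB addrACA.
  by rewrite [a + (p - a)]addrC subrK.
apply: (le_trans (rnormB_le _ _)).
apply: (le_trans (lerD (ler_rnormD _ _) (ler_rnormD _ _))).
have -> : 2 * (2 * M) = (M + M) + (M + M) by ring.
by rewrite !lerD.
Qed.

(** The previous bound for B = p (x) q^* is evaluated at the vector U v. *)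
Lemma rank_one_bound A Z (r M : R) U V p q v :
  (forall U V, is_inverse U V -> rnorm (U - Z) < r -> rnorm (U * A * V) <= M) ->
  is_inverse U V -> dot p q = 0 ->
  opnorm (U - Z) + opnorm U * (rnorm p * rnorm q) < r ->
  mdot (A p) q * (mdot v q * rnorm (U p)) <= 2 * M * rnorm (U v).
Proof.
move=> AM UV pq Ur.
have UBV := opnorm_conj_nilpotent AM UV (rank_one_nilpotent hdot pq) _.
have {}UBV : opnorm (U * (rank_one p q * A * rank_one p q) * V) <= 2 * M.
  apply: UBV; apply: le_lt_trans Ur; rewrite lerD2l ler_wpM2l ?opnorm_ge0//.
  exact: opnorm_rank_one.
apply: le_trans (ler_wpM2r (rnorm_ge0 (U v)) UBV).
apply: le_trans (opnormP _ _); rewrite rank_one_conj !bop_mulE.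
have -> : V (U v) = v by rewrite -bop_mulE UV.2.
by rewrite bop_scaleE rank_oneE !bopZ !rnormZ.
Qed.

Lemma mdot_self x : mdot x x = rnorm x ^+ 2.
Proof.
apply: complexI; rewrite Re_normrK -hdot rmorphXn /= rnormE.
by rewrite ger0_norm// exprn_ge0.
Qed.

Lemma mdotZr (t : R) x q : 0 < t -> mdot x (t%:C *: q) = t * mdot x q.
Proof.
move=> t0; have tn : `|t%:C| = t%:C :> R[i] by rewrite ger0_norm// lecR ltW.
by apply: complexI; rewrite rmorphM /= !Re_normrK dotZr normrM norm_conjC tn.
Qed.

Lemma Re_normr_lerB (a b : R[i]) : complex.Re `|a| - complex.Re `|b| <= complex.Re `|a + b|.
Proof. by rewrite -lecR rmorphB /= !Re_normrK lerB_normD. Qed.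

(** U stays bounded below on the line of p but nearly kills v, so the unit vector v cannot be close
    to a multiple of p. *)
Lemma approximate_kernel_component U Z p v (k L : R) (b : R[i]) : p != 0 -> 0 < k ->
  rnorm (Z p) = 4 * k * rnorm p -> opnorm (U - Z) <= 2 * k -> opnorm U <= L ->
  rnorm v = 1 -> rnorm (U v) <= k ->
  2 * k * rnorm p <= rnorm (U p) /\ k / (L + 2 * k) <= rnorm (v - b *: p).
Proof.
move=> p0 k0 Zp UZ UL v1 Uv.
have UZp : rnorm ((U - Z) p) <= 2 * k * rnorm p.
  by apply: (le_trans (opnormP _ _)); rewrite ler_wpM2r ?rnorm_ge0.
have Up : 2 * k * rnorm p <= rnorm (U p).
  have : rnorm (Z p) <= rnorm (U p) + rnorm ((U - Z) p).
    by rewrite -[X in rnorm X](subKr (U p)) rnormB_le.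
  by rewrite Zp; lra.
split => //; set n := rnorm (v - _).
have L0 : 0 <= L by apply: le_trans UL; exact: opnorm_ge0.
rewrite ler_pdivrMr; last lra.
have v1n : 1 <= n + complex.Re `|b| * rnorm p.
  by rewrite -v1 -rnormZ -[X in rnorm X <= _](subrK (b *: p)) ler_rnormD.
have Ubp : complex.Re `|b| * rnorm (U p) <= rnorm (U v) + L * n.
  rewrite -rnormZ -bopZ -[X in rnorm (U X)](subKr v) bopB.
  apply: (le_trans (rnormB_le _ _)); rewrite lerD2l; apply: (le_trans (opnormP _ _)).
  by rewrite ler_wpM2r ?rnorm_ge0.
have bU : complex.Re `|b| * (2 * k * rnorm p) <= complex.Re `|b| * rnorm (U p).
  by rewrite ler_wpM2l ?Re_normr_ge0.
have : 2 * k * 1 <= 2 * k * (n + complex.Re `|b| * rnorm p).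
  by rewrite ler_wpM2l// mulr_ge0// ltW.
move: (complex.Re `|b|) (rnorm p) (rnorm (U p)) (rnorm (U v)) n Uv v1n Ubp bU => b' p' u' w n.
clear -k0; move=> Uv v1n Ubp bU h; nra.
Qed.

(** Let a be the component of A p orthogonal to p. If a <> 0, an almost-kernel vector v with
    orthogonal component v' forces |<a, q>| |<v', q>| to be tiny for all q orthogonal to p of
    bounded norm, which fails for a suitable q. *)
Lemma Scap_eigen A Z (r M : R) p : 0 < r ->
  (forall U V, is_inverse U V -> rnorm (U - Z) < r -> rnorm (U * A * V) <= M) ->
  ~ invertible Z -> closure (@invertible R X) Z -> Z p != 0 ->
  exists c, A p = c *: p.
Proof.
move=> r0 AM nZ clZ Zp0.
have p0 : p != 0 by apply: contraNneq Zp0 => ->; rewrite bop0.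
have [c] := ortho_component dot (A p) p.
move: (A p - c *: p) (subrK (c *: p) (A p)) => a aE ap.
have [a0|a0] := eqVneq a 0; first by exists c; rewrite -aE a0 add0r.
exfalso.
have al0 : 0 < rnorm a by rewrite rnorm_gt0.
have pi0 : 0 < rnorm p by rewrite rnorm_gt0.
have ze0 : 0 < rnorm (Z p) by rewrite rnorm_gt0.
pose L := opnorm Z + r; have L0 : 0 < L by rewrite ltr_wpDl ?opnorm_ge0.
pose k := rnorm (Z p) / (4 * rnorm p).
have k0 : 0 < k by rewrite divr_gt0 ?mulr_gt0.
have Zpk : rnorm (Z p) = 4 * k * rnorm p.
  by rewrite /k; field; rewrite gt_eqF.
pose n0 := k / (L + 2 * k).
have n00 : 0 < n0 by rewrite divr_gt0// addr_gt0// mulr_gt0.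
have a1 : 0 < rnorm a + 1 by rewrite addr_gt0.
(* The factor t shrinks q so that the perturbation fits in the ball; |a| + 1 bounds the norms of
   both test vectors used below. *)
have [t t0 tE] : exists2 t, 0 < t & L * (rnorm p * (t * (rnorm a + 1))) = r / 4.
  exists (r / 4 / (L * rnorm p * (rnorm a + 1))); first by rewrite !divr_gt0 ?mulr_gt0.
  by field; rewrite !gt_eqF.
(* The two halves of the minimum keep |<a, a + v'>| >= |a|^2 / 2 and |<v', a + v'>| >= 3 n0^2 /
   4. *)
pose kappa := Num.min (rnorm a ^+ 2 / 2) (n0 ^+ 2 / 4).
have kappa0 : 0 < kappa by rewrite lt_min !divr_gt0 ?exprn_gt0.
have ka : kappa <= rnorm a ^+ 2 / 2 by rewrite ge_min lexx.
have kn : kappa <= n0 ^+ 2 / 4 by rewrite ge_min lexx orbT.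
pose D := t ^+ 2 * rnorm p * k.
have D0 : 0 < D by rewrite /D mulr_gt0// mulr_gt0// exprn_gt0.
(* For |U v| < eta, dividing [rank_one_bound] by 2D leaves at most kappa |a|^2, which is [key]. *)
pose eta := Num.min k (kappa * rnorm a ^+ 2 * D / (`|M| + 1)).
have M1 : 0 < `|M| + 1 by rewrite ltr_wpDl.
have eta0 : 0 < eta.
  by rewrite lt_min k0 divr_gt0// mulr_gt0// mulr_gt0// exprn_gt0.
have etak : eta <= k by rewrite ge_min lexx.
have etaM : `|M| * eta <= kappa * rnorm a ^+ 2 * D.
  have : eta <= kappa * rnorm a ^+ 2 * D / (`|M| + 1) by rewrite ge_min lexx orbT.
  rewrite ler_pdivlMr// mulrC; apply: le_trans.
  by rewrite ler_wpM2r ?lerDl// ltW.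
have [|U [V [v [UV Ur v1 Uv]]]] := approximate_kernel (r := Num.min (r / 2) (2 * k)) nZ clZ _ eta0.
  by rewrite lt_min divr_gt0// mulr_gt0.
move: Ur; rewrite lt_min => /andP[Ur Uk].
have UL : opnorm U <= L.
  rewrite -[U](subrK Z) addrC -bop_rnormE; apply: (le_trans (ler_rnormD Z (U - Z))); rewrite lerD2l.
  by rewrite ltW// (lt_trans Ur)// ltr_pdivrMr// ltr_pMr// ltr1n.
have [b v'p] := ortho_component dot v p.
have [Up nv] := approximate_kernel_component b p0 k0 Zpk (ltW Uk) UL v1 (le_trans (ltW Uv) etak).
have key q : dot p q = 0 -> rnorm q <= rnorm a + 1 ->
    mdot (A p) q * mdot v q <= kappa * rnorm a ^+ 2.
  move=> pq qa; have tq : rnorm (t%:C *: q) = t * rnorm q.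
    by rewrite rnormZ Re_normr_real gtr0_norm.
  have := rank_one_bound (q := t%:C *: q) (p := p) v AM UV.
  rewrite dotZr pq mulr0 => /(_ erefl); rewrite tq !mdotZr// => bound.
  have {}/bound : opnorm (U - Z) + opnorm U * (rnorm p * (t * rnorm q)) < r.
    apply: (@lt_le_trans _ _ (r / 2 + r / 4)); last lra.
    apply: ltr_leD => //; rewrite -tE; apply: ler_pM => //; first exact: opnorm_ge0.
      by rewrite !mulr_ge0 ?rnorm_ge0 ?(ltW t0).
    by rewrite !ler_pM2l.
  move=> bound; rewrite -(ler_pM2r D0); apply: le_trans etaM.
  have h1 : 2 * M * rnorm (U v) <= 2 * (`|M| * eta).
    rewrite -mulrA ler_pM2l//; apply: (@le_trans _ _ (`|M| * rnorm (U v))).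
      by rewrite ler_wpM2r ?rnorm_ge0// ler_norm.
    by rewrite ler_wpM2l// ltW.
  have h2 : mdot (A p) q * mdot v q * t ^+ 2 * (2 * k * rnorm p) <=
      mdot (A p) q * mdot v q * t ^+ 2 * rnorm (U p).
    by rewrite ler_wpM2l// !mulr_ge0 ?Re_normr_ge0// ltW.
  have h3 := le_trans h2 (le_trans _ h1).
  have {}/h3 : mdot (A p) q * mdot v q * t ^+ 2 * rnorm (U p) <= 2 * M * rnorm (U v).
    by apply: le_trans bound; rewrite le_eqVlt; apply/orP; left; apply/eqP; ring.
  have -> : mdot (A p) q * mdot v q * t ^+ 2 * (2 * k * rnorm p) =
    2 * (mdot (A p) q * mdot v q * D) by rewrite /D; ring.
  by rewrite ler_pM2l.
have Aa q : dot p q = 0 -> dot (A p) q = dot a q.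
  by move=> pq; rewrite -aE dotDl dotZl pq mulr0 addr0.
have va q : dot p q = 0 -> dot v q = dot (v - b *: p) q.
  by move=> pq; rewrite dotBl dotZl pq mulr0 subr0.
have pa := dot_ortho_sym ap; have pv' := dot_ortho_sym v'p.
have v'1 : rnorm (v - b *: p) <= 1.
  rewrite -(ler_pXn2r (n := 2)) ?nnegrE ?rnorm_ge0// -v1 -!mdot_self -lecR !Re_normrK.
  rewrite !ger0_norm ?(dnorm_ge0 dot)// -[in leRHS](subrK (b *: p) v).
  by rewrite (dot_pythagoras _ v'p) lerDl mulr_ge0 ?exprn_ge0// (dnorm_ge0 dot).
move: (v - b *: p) nv va pv' v'1 => v' nv va pv' v'1.
(* The test vectors q = a and q = a + v' give incompatible bounds. *)
have := key a pa; rewrite (Aa _ pa) (va _ pa) mdot_self lerDl => /(_ ler01).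
rewrite mulrC ler_pM2r ?exprn_gt0// => kv.
have kv2 : mdot a v' <= kappa by rewrite dotC norm_conjC.
have pav : dot p (a + v') = 0 by rewrite dotDr pa pv' addr0.
have := key (a + v') pav; rewrite (Aa _ pav) (va _ pav) !dotDr => key2.
have {}key2 := key2 (le_trans (ler_rnormD _ _) (lerD (lexx _) v'1)).
have h1 := Re_normr_lerB (dot a a) (dot a v').
have := Re_normr_lerB (dot v' v') (dot v' a); rewrite [dot v' v' + _]addrC => h2.
rewrite mdot_self in h1; rewrite mdot_self in h2.
have nn : n0 ^+ 2 <= rnorm v' ^+ 2.
  by rewrite ler_pXn2r// ?nnegrE ?rnorm_ge0// ltW.
have g1 : rnorm a ^+ 2 / 2 <= complex.Re `|dot a a + dot a v'| by move: h1 kv2 ka; clear; lra.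
have g2 : n0 ^+ 2 * (3 / 4) <= complex.Re `|dot v' a + dot v' v'|.
  by move: h2 kv kn nn; clear; lra.
have A0 : 0 < rnorm a ^+ 2 by rewrite exprn_gt0.
have N0 : 0 < n0 ^+ 2 by rewrite exprn_gt0.
(* The product is at least 3/8 of |a|^2 n0^2, while kappa allows at most 1/4 of it. *)
have : rnorm a ^+ 2 / 2 * (n0 ^+ 2 * (3 / 4)) <= kappa * rnorm a ^+ 2.
  by apply: le_trans key2; apply: ler_pM => //; move: A0 N0; clear; lra.
have : kappa * rnorm a ^+ 2 <= n0 ^+ 2 / 4 * rnorm a ^+ 2 by rewrite ler_pM2r.
move: (rnorm a ^+ 2) (n0 ^+ 2) A0 N0 => x y; clear; nra.
Qed.

Lemma Scap_id_scalar A Z : ~ invertible Z -> closure (@invertible R X) Z ->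
  Scap_id Z A -> exists c, A = c *: (1 : bop X X).
Proof.
move=> nZ clZ /ScapP[r [M [r0 AM]]].
have {}AM U V : is_inverse U V -> rnorm (U - Z) < r -> rnorm (U * A * V) <= M := @AM U V.
apply: (scalar_operatorP (dot := dot)) => p q pq.
have [Z0|/existsNP[w /eqP Zw]] := pselect (forall x, Z x = 0); last first.
  have [Zp|Zp] := eqVneq (Z p) 0; last first.
    by have [c ->] := Scap_eigen r0 AM nZ clZ Zp; rewrite dotZl pq mulr0.
  (* For p in the kernel of Z, the vectors w, p + w and p - w lie outside it, hence are
     eigenvectors; this gives two expressions of A p in p and w. *)
  have eig t : t != 0 -> exists c, A (p + t *: w) = c *: (p + t *: w).
    move=> t0; apply: (Scap_eigen r0 AM nZ clZ).
    by rewrite bopD bopZ Zp add0r scaler_eq0 negb_or t0.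
  have [c Aw] := Scap_eigen r0 AM nZ clZ Zw.
  have [d] := eig 1 (oner_neq0 _); have [|e] := eig (-1); first by rewrite oppr_eq0 oner_neq0.
  rewrite !scaleN1r !scale1r bopB bopD Aw => Am Ap.
  have Ap2 : A p = d *: p + (d - c) *: w by rewrite scalerBl addrA -scalerDr -Ap addrK.
  have Am2 : A p = e *: p + (c - e) *: w.
    by rewrite scalerBl [c *: w - _]addrC addrA -scalerBr -Am subrK.
  have scalI (a b : R[i]) x : x != 0 -> a *: x = b *: x -> a = b.
    move=> x0 /eqP; rewrite -subr_eq0 -scalerBl scaler_eq0 (negPf x0) orbF subr_eq0.
    by move/eqP.
  (* Applying Z kills p and isolates the coefficients of w. *)
  have dce : d - c = c - e.
    apply: (scalI _ _ _ Zw); have := congr1 Z Ap2; rewrite Am2 !bopD !bopZ Zp !scaler0.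
    by rewrite !add0r.
  have [->|p0] := eqVneq p 0; first by rewrite bop0 dot0l.
  have de : d = e by apply: (scalI _ _ _ p0); move: Am2; rewrite Ap2 dce => /addIr.
  suff dc : d = c by rewrite Ap2 dc subrr scale0r addr0 dotZl pq mulr0.
  have /eqP : (d - c) *+ 2 = 0 by rewrite mulr2n {2}dce de addrA subrK subrr.
  by rewrite mulrn_eq0 /= subr_eq0 => /eqP.
(* Now Z = 0: with U = s I and s small, p may be dilated by any t > 0. *)
have [->|q0] := eqVneq q 0; first by rewrite dot0r.
have [->|p0] := eqVneq p 0; first by rewrite bop0 dot0l.
apply/eqP; apply: contraT => d0.
have m0 : 0 < mdot (A p) q by rewrite -ltcR Re_normrK normr_gt0.
have pi0 : 0 < rnorm p by rewrite rnorm_gt0.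
have qi0 : 0 < rnorm q by rewrite rnorm_gt0.
have Z00 : Z = 0 by exact: bop_ext.
have opn1 : opnorm (1 : bop X X) <= 1 by apply: opnorm_le.
have bound (t : R) : 0 < t -> t ^+ 2 * (mdot (A p) q * (rnorm q * rnorm p)) <= 2 * M.
  move=> t0.
  have e0 : 0 < 1 + t * rnorm p * rnorm q by rewrite addr_gt0// !mulr_gt0.
  have [s s0 sE] : exists2 s : R, 0 < s & s * (1 + t * rnorm p * rnorm q) = r / 2.
    by exists (r / 2 / (1 + t * rnorm p * rnorm q)); rewrite ?divfK ?gt_eqF// !divr_gt0.
  have sC0 : s%:C != 0 :> R[i] by rewrite fmorph_eq0 gt_eqF.
  have inv : is_inverse (s%:C *: (1 : bop X X)) (s%:C^-1 *: (1 : bop X X)).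
    by split; rewrite bop_scalerAl bop_scalerAr mulr1 scalerA ?mulfV ?mulVf// scale1r.
  have ns : opnorm (s%:C *: (1 : bop X X)) <= s.
    rewrite -bop_rnormE rnormZ Re_normr_real gtr0_norm// -[leRHS]mulr1 ler_wpM2l//.
    exact: ltW.
  have tp : dot (t%:C *: p) q = 0 by rewrite dotZl pq mulr0.
  have := rank_one_bound q AM inv tp.
  have -> : opnorm (s%:C *: (1 : bop X X) - Z) = opnorm (s%:C *: (1 : bop X X)).
    by rewrite Z00 subr0.
  have ntp : rnorm (t%:C *: p) = t * rnorm p by rewrite rnormZ Re_normr_real gtr0_norm.
  have sq (y : X) : (s%:C *: (1 : bop X X)) y = s%:C *: y by [].
  rewrite !sq !rnormZ !Re_normr_real (gtr0_norm s0) (gtr0_norm t0) => b.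
  have {}/b : opnorm (s%:C *: (1 : bop X X)) +
      opnorm (s%:C *: (1 : bop X X)) * (t * rnorm p * rnorm q) < r.
    apply: (@le_lt_trans _ _ (s + s * (t * rnorm p * rnorm q))).
      by rewrite lerD// ler_wpM2r// !mulr_ge0 ?rnorm_ge0// ltW.
    by rewrite -{1}[s]mulr1 -mulrDr sE ltr_pdivrMr// ltr_pMr// ltr1n.
  have -> : mdot (A (t%:C *: p)) q = t * mdot (A p) q.
    apply: complexI; rewrite rmorphM /= !Re_normrK bopZ dotZl normrM; congr (_ * _).
    by rewrite ger0_norm// lecR ltW.
  rewrite (mdot_self q) => b; rewrite -(ler_pM2r (mulr_gt0 s0 qi0)).
  by move: b; congr (_ <= _); ring.
have c0 : 0 < mdot (A p) q * (rnorm q * rnorm p) by rewrite !mulr_gt0.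
have M0 : 0 <= M.
  have := bound 1 ltr01; rewrite expr1n mul1r; move: c0; lra.
move: (mdot (A p) q * _) bound c0 => c bound c0.
have u0 : 0 <= 2 * M / c by exact: (divr_ge0 (mulr_ge0 (ler0n _ 2) M0) (ltW c0)).
(* With u = 2M / c and t = 1 + u, the bound reads (1 + u)^2 <= u, impossible for u >= 0. *)
have := bound (1 + 2 * M / c); rewrite -[leRHS](divfK (lt0r_neq0 c0)).
move: (2 * M / c) u0 => u u0; have u1 : 0 < 1 + u by lra.
rewrite ler_pM2r// => /(_ u1); nra.
Qed.

End SingularScap.

(** * Finite dimension and the resulting dichotomy *)

Lemma finite_dim_orthogonal {R : realType} {X : normedModType R[i]}
    (dot : {dot X for (@Num.conj R[i])}) (n : nat) : has_dimension X n ->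
  exists s : seq X, forall h, {in s, forall f, dot f h = 0} -> h = 0.
Proof.
move=> [f [g fg gf]]; exists [seq f (delta_mx 0 j) | j <- enum 'I_n] => h sh.
apply: (dot_self_eq0 (dot := dot)).
rewrite -{1}[h]gf [g h]row_sum_delta linear_sum /= linear_sumlz big1// => j _.
rewrite linearZ /= dotZl sh ?mulr0//.
by apply: (map_f (fun j => f (delta_mx 0 j))); rewrite mem_enum.
Qed.

Theorem theorem1p14 (R : realType) (X : completeNormedModType R[i])
  (dot : {dot X for (@Num.conj R[i])}) (hdot : is_inner_product dot)
  (Z : bop X X) (hZ : ~ invertible Z) :
  (closure (@invertible R X) Z -> Scap_id Z = @scalar_operators R X)
  /\
  (forall n : nat, has_dimension X n ->
   forall phi : bop (bop X X) (bop X X),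
     Scap phi Z = @scalar_operators R X \/ Scap phi Z = [set: bop X X]).
Proof.
have scalars phi : @scalar_operators R X `<=` @Scap R X (bop X X) phi Z.
  by move=> _ [a _ <-]; exact: (Scap_scalar phi Z a).
split=> [clZ|n dimX phi].
  apply/seteqP; split=> [A SA|]; last exact: scalars.
  by have [a ->] := Scap_id_scalar hdot hZ clZ SA; exists a.
(* A single nonscalar element makes [Scap phi Z] everything, by [subspace_full]. *)
have [[A [SA nA]]|h] := pselect (exists A, Scap phi Z A /\ ~ exists a, A = a *: (1 : bop X X)).
  right; apply/seteqP; split=> [|T _]; first exact: subsetT.
  have [s s0] := finite_dim_orthogonal dot dimX.
  apply: (subspace_full hdot _ _ _ _ T s0 SA nA).
  - by rewrite -[1](scale1r (1 : bop X X)); exact: Scap_scalar.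
  - exact: ScapD.
  - exact: ScapZ.
  - exact: Scap_nilpotent.
left; apply/seteqP; split=> [A SA|]; last exact: scalars.
have [[a ->]|nA] := pselect (exists a, A = a *: (1 : bop X X)); first by exists a.
by case: h; exists A.
Qed.
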